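(* Let $\mathcal C_P=\{z_q\}_{q=1}^P$ be a finite candidate set of points with scalar residual rows $\psi(z_q)\in\mathbb{R}^M$, let $\lambda_{\rm g}>0$, let $\mathbf{x}_1,\ldots,\mathbf{x}_k\in\mathcal C_P$ be the points already selected, and let $$G_k=\lambda_{\rm g}I_M+\sum_{j=1}^k\psi(\mathbf{x}_j)\psi(\mathbf{x}_j)^\top .$$ Let $\mathcal C_P^{(k)}=\mathcal C_P\setminus\{\mathbf{x}_1,\ldots,\mathbf{x}_k\}$ be the (nonempty) set of remaining candidates. Then any $$\mathbf{x}_{k+1}\in\arg\max_{\mathbf{x}\in\mathcal C_P^{(k)}}\psi(\mathbf{x})^\top G_k^{-1}\psi(\mathbf{x})$$ maximizes $\log\det G_{k+1}-\log\det G_k$ over the remaining candidates $\mathcal C_P^{(k)}$, where $G_{k+1}=G_k+\psi(\mathbf{x})\psi(\mathbf{x})^\top$ when candidate $\mathbf{x}$ is chosen.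
   Context: For a fixed linear operator $L$ and fixed trial functions $\varphi_1,\ldots,\varphi_M$, the residual row at a point $\mathbf{x}$ is $\psi(\mathbf{x})=(L\varphi_1(\mathbf{x}),\ldots,L\varphi_M(\mathbf{x}))^\top\in\mathbb{R}^M$. $I_M$ is the $M\times M$ identity matrix. The points are selected one at a time without replacement, starting from $G_0=\lambda_{\rm g}I_M$. *)

(* Defs.v *)
From HB Require Import structures.
From mathcomp Require Import all_boot all_order all_algebra finmap.
From mathcomp Require Import classical_sets functions reals exp.

Set Implicit Arguments.
Unset Strict Implicit.
Unset Printing Implicit Defensive.

Import Order.TTheory GRing.Theory Num.Theory.

Local Open Scope fset_scope.
Local Open Scope ring_scope.

(* V is the function space on which L is defined (any left R-module, e.g. a
   space of smooth functions); the values of L are scalar functions on X. *)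
Definition residual_row (R : realType) (X : choiceType) (V : lmodType R)
    (M : nat) (L : {linear V -> (X -> R^o)}) (phi : 'I_M -> V) (x : X)
    : 'cV[R]_M :=
  \col_(i < M) (L (phi i) x : R).

Definition rank_one (R : realType) (M : nat) (v : 'cV[R]_M) : 'M[R]_M :=
  v *m v^T.

Definition gram (R : realType) (X : choiceType) (M k : nat) (lambda : R)
    (psi : X -> 'cV[R]_M) (x : 'I_k -> X) : 'M[R]_M :=
  lambda%:M + \sum_(j < k) rank_one (psi (x j)).

Definition inv_quad_form (R : realType) (M : nat) (G : 'M[R]_M) (v : 'cV[R]_M)
    : R :=
  (v^T *m invmx G *m v) 0 0.

Definition log_det (R : realType) (M : nat) (G : 'M[R]_M) : R := ln (\det G).

Definition remaining (X : choiceType) (k : nat) (C : {fset X}) (x : 'I_k -> X)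
    : {fset X} :=
  C `\` [fset x j | j in 'I_k].

Definition argmax (R : realType) (X : choiceType) (A : {fset X}) (f : X -> R)
    : set X :=
  [set a | a \in A /\ forall b, b \in A -> f b <= f a]%classic.

(* Main.v *)
Require Import Defs.
From HB Require Import structures.
From mathcomp Require Import all_boot all_order all_algebra finmap.
From mathcomp Require Import classical_sets functions reals exp.

Set Implicit Arguments.
Unset Strict Implicit.
Unset Printing Implicit Defensive.

Import Order.TTheory GRing.Theory Num.Theory.

Local Open Scope fset_scope.
Local Open Scope ring_scope.

(** The matrix determinant lemma gives
    det (G + v v^T) = det G * (1 + v^T G^-1 v), so that choosing a candidate
    with residual row v raises log det G by exactly
    ln (1 + v^T G^-1 v).  This gain is an increasing function of
    v^T G^-1 v, hence both criteria have the same maximizers.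

    The logarithms are meaningful because det G > 0 and v^T G^-1 v >= 0.
    Both follow from one invariant, that the matrix has a nonnegative quadratic
    form and a positive determinant: it holds for lambda I and, by the
    determinant lemma itself, survives every update by v v^T. *)

(** The two sides are the determinants of two block-triangular factorizations
    of the matrix with rows (A, B) and (- C, 1), each eliminating one of its
    off-diagonal blocks. *)
Lemma det_add_mulmx (R : comUnitRingType) (m n : nat) (A : 'M[R]_m)
    (B : 'M[R]_(m, n)) (C : 'M[R]_(n, m)) :
  A \in unitmx ->
  \det (A + B *m C) = \det A * \det (1%:M + C *m invmx A *m B).
Proof.
move=> Au.
have elim_B : block_mx A B (- C) 1%:M =
    block_mx 1%:M B 0 1%:M *m block_mx (A + B *m C) 0 (- C) 1%:M.
  by rewrite mulmx_block !mul1mx !mul0mx !mulmx1 !add0r mulmxN addrK.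
have elim_C : block_mx A B (- C) 1%:M =
    block_mx 1%:M 0 (- (C *m invmx A)) 1%:M
      *m block_mx A B 0 (1%:M + C *m invmx A *m B).
  rewrite mulmx_block !mul1mx !mul0mx !addr0 !mulNmx mulmxKV //.
  by rewrite addrCA addNr addr0.
move: elim_C; rewrite elim_B => /(congr1 determinant).
by rewrite !det_mulmx !(det_ublock, det_lblock) !det1 !mul1r mulr1.
Qed.

Lemma det_rank_one_update (R : realType) (M : nat) (A : 'M[R]_M)
    (v : 'cV[R]_M) :
  A \in unitmx ->
  \det (A + rank_one v) = \det A * (1 + inv_quad_form A v).
Proof.
by move=> Au; rewrite det_add_mulmx // det_mx11 mxE [1%:M 0 0]mxE eqxx.
Qed.

(** For symmetric matrices this is positive definiteness.  In this form it
    passes from A to A + v v^T directly, and it provides precisely the two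
    facts used about the Gram matrix. *)
Definition semidefinite_det_gt0 (R : realType) (M : nat) (A : 'M[R]_M) :=
  (forall u : 'cV[R]_M, 0 <= (u^T *m A *m u) 0 0) /\ 0 < \det A.

Lemma semidefinite_det_gt0_unitmx (R : realType) (M : nat) (A : 'M[R]_M) :
  semidefinite_det_gt0 A -> A \in unitmx.
Proof. by case=> _ detA; rewrite unitmxE unitfE gt_eqF. Qed.

(** With v = A u, the value v^T A^-1 v is u^T A^T u, a 1 x 1 matrix and hence
    equal to its transpose u^T A u. *)
Lemma inv_quad_form_ge0 (R : realType) (M : nat) (A : 'M[R]_M)
    (v : 'cV[R]_M) :
  semidefinite_det_gt0 A -> 0 <= inv_quad_form A v.
Proof.
move=> Apos; have Au := semidefinite_det_gt0_unitmx Apos.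
rewrite /inv_quad_form -[v](mulKVmx Au) -mulmxA mulKmx //.
set u := invmx A *m v.
have -> : ((A *m u)^T *m u) 0 0 = ((A *m u)^T *m u)^T 0 0 by rewrite [RHS]mxE.
by rewrite trmx_mul trmxK mulmxA; apply: Apos.1.
Qed.

Lemma quad_form_rank_one_ge0 (R : realType) (M : nat) (u v : 'cV[R]_M) :
  0 <= (u^T *m rank_one v *m u) 0 0.
Proof.
(* The value is the square of the scalar v^T u. *)
have -> : u^T *m rank_one v *m u = (v^T *m u)^T *m (v^T *m u).
  by rewrite trmx_mul trmxK !mulmxA.
by rewrite mxE big_ord1 mxE -expr2 sqr_ge0.
Qed.

Lemma semidefinite_det_gt0_rank_one (R : realType) (M : nat) (A : 'M[R]_M)
    (v : 'cV[R]_M) :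
  semidefinite_det_gt0 A -> semidefinite_det_gt0 (A + rank_one v).
Proof.
move=> Apos; split=> [u|].
  rewrite mulmxDr mulmxDl mxE addr_ge0 ?quad_form_rank_one_ge0 //.
  exact: Apos.1.
rewrite det_rank_one_update ?semidefinite_det_gt0_unitmx //.
by rewrite mulr_gt0 ?Apos.2 // ltr_pwDl // inv_quad_form_ge0.
Qed.

Lemma semidefinite_det_gt0_scalar (R : realType) (M : nat) (lambda : R) :
  0 < lambda -> semidefinite_det_gt0 (lambda%:M : 'M[R]_M).
Proof.
move=> lambda_gt0; split=> [u|]; last by rewrite det_scalar exprn_gt0.
rewrite mul_mx_scalar -scalemxAl mxE; apply: mulr_ge0; first exact: ltW.
rewrite mxE; apply: sumr_ge0 => i _.
by rewrite mxE -expr2 sqr_ge0.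
Qed.

Lemma gram_semidefinite_det_gt0 (R : realType) (X : choiceType) (M k : nat)
    (lambda : R) (psi : X -> 'cV[R]_M) (x : 'I_k -> X) :
  0 < lambda -> semidefinite_det_gt0 (gram lambda psi x).
Proof.
move=> lambda_gt0; rewrite /gram.
elim/big_rec: _ => [|j A _ IH].
  by rewrite addr0; apply: semidefinite_det_gt0_scalar.
by rewrite [rank_one _ + A]addrC addrA; apply: semidefinite_det_gt0_rank_one.
Qed.

Theorem proposition1 (R : realType) (X : choiceType) (V : lmodType R)
    (M k : nat) (L : {linear V -> (X -> R^o)}) (phi : 'I_M -> V)
    (C : {fset X}) (lambda : R) (x : 'I_k -> X)
    (lambda_gt0 : 0 < lambda)
    (x_in_C : forall j : 'I_k, x j \in C)
    (x_inj : injective x)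
    (remaining_neq0 : remaining C x != fset0) :
  let psi := residual_row L phi in
  let G := gram lambda psi x in
  forall xnext : X,
    argmax (remaining C x) (fun y => inv_quad_form G (psi y)) xnext ->
    argmax (remaining C x)
      (fun y => log_det (G + rank_one (psi y)) - log_det G) xnext.
Proof.
move=> psi G xnext [xnextA xnext_max]; split=> // y yA.
have Gpos : semidefinite_det_gt0 G by exact: gram_semidefinite_det_gt0.
have logdet_gain z :
    log_det (G + rank_one (psi z)) = log_det G + ln (1 + inv_quad_form G (psi z)).
  rewrite /log_det det_rank_one_update ?semidefinite_det_gt0_unitmx //.
  have q_ge0 := inv_quad_form_ge0 (psi z) Gpos.
  by rewrite lnM // posrE ?Gpos.2 // ltr_pwDl.
rewrite !logdet_gain !(addrC (log_det G)) !addrK ler_ln ?posrE; last 2 first.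
- by rewrite ltr_pwDl // inv_quad_form_ge0.
- by rewrite ltr_pwDl // inv_quad_form_ge0.
by rewrite lerD2l xnext_max.
Qed.
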